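(* Fix $\pi_0\in(0,1]$, $\alpha\in(0,1)$ and $L>0$. Let $\phi_n(\pi_0)$ be the test that rejects when $T_n(\pi_0)>c_{n,\alpha}(\pi_0)$, where $$T_n(\pi_0)=\max_{0\le\lambda<1}\sqrt{n(1-\lambda)}\,[\pi_0-\hat\pi(\lambda)],\qquad \hat\pi(\lambda)=\frac{1}{n(1-\lambda)}\sum_{i=1}^nI(\hat p_i>\lambda),$$ and $c_{n,\alpha}(\pi_0)$ is the $1-\alpha$ quantile of $T_n(\pi_0)$ when $\hat p_1,\dots,\hat p_n$ are i.i.d. from the distribution $\pi_0\cdot\mathrm{unif}(0,1)+(1-\pi_0)\cdot\delta_0$. Then $\phi_n(\pi_0)$ is level $\alpha$ for the null hypothesis $H_0: f_p(x)\ge\pi_0$ for all $x\in[0,1]$. Furthermore, there exists a constant $C^*$ such that, for all $\varepsilon\in(0,1]$, $$\lim_{n\to\infty}\ \inf_{\beta\in[\varepsilon,1]}\ \inf_{f_p\in\mathcal{G}^{\pi_0}(C^*(n/\log\log n)^{-\beta/(2\beta+1)},L,\beta)}E_{f_p}\phi_n(\pi_0)=1 .$$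
   Context: One observes $p$-values $\hat p_1,\dots,\hat p_n$, i.i.d. from a probability density $f_p$ on $[0,1]$ of the mixture form $f_p(x)=\pi\cdot I(x\in[0,1])+(1-\pi)f_1(x)$, where $\pi\in[0,1]$ is the proportion of true null hypotheses and $f_1$ is an unknown density on $[0,1]$. $E_{f_p}$ denotes expectation when the density is $f_p$. $\delta_0$ is the unit mass at $0$ and $\mathrm{unif}(0,1)$ the uniform distribution on $(0,1)$. A test is identified with its rejection indicator; level $\alpha$ means $E_{f_p}\phi_n(\pi_0)\le\alpha$ for every $f_p$ satisfying the null. The maximum in $T_n(\pi_0)$ is attained. $\log\log n$ is used for $n\ge3$. For $L>0$, $0\le\beta\le1$, $\Sigma(L,\beta)=\{f:\ |f(x)-f(x')|\le L|x-x'|^\beta\text{ for all }x,x'\}$ (here $x,x'\in[0,1]$), and $\mathcal{G}^{\pi_0}(b,L,\beta)$ is the set of densities $f_p$ on $[0,1]$ with $f_p(1)\le\pi_0-b$ and $f_p\in\Sigma(L,\beta)$. An infimum of rejection probabilities over an empty class is taken to be $1$. *)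

(* Defs.v *)
From HB Require Import structures.
From mathcomp Require Import all_boot all_order all_algebra.
From mathcomp Require Import all_classical all_reals all_analysis.
From mathcomp Require Import measurable_realfun.

Set Implicit Arguments.
Unset Strict Implicit.
Unset Printing Implicit Defensive.

Import Order.TTheory GRing.Theory Num.Theory.
Import numFieldNormedType.Exports.

Local Open Scope classical_set_scope.
Local Open Scope ring_scope.

Section iid_law.
Context d (T : measurableType d) (R : realType) (P : probability T R).

Definition tcons n (xt : T * n.-tuple T) : n.+1.-tuple T :=
  [the n.+1.-tuple T of xt.1 :: xt.2].

Lemma measurable_tcons n : measurable_fun [set: T * n.-tuple T] (@tcons n).
Proof. exact: (measurable_cons measurable_fst measurable_snd). Qed.

HB.instance Definition _ n :=
  isMeasurableFun.Build _ _ _ _ (@tcons n) (@measurable_tcons n).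

(* The n-fold product measure, i.e. the joint law of n i.i.d. variables of
   law P. *)
Fixpoint iid_law n : probability (n.-tuple T) R :=
  match n with
  | 0 => \d_([tuple] : 0.-tuple T)
  | m.+1 => distribution (P \x iid_law m)%E (@tcons m)
  end.

Lemma measurable_box n (A : 'I_n -> set T) : (forall i, measurable (A i)) ->
  measurable [set x : n.-tuple T | forall i, A i (tnth x i)].
Proof.
move=> mA.
rewrite (_ : mkset _ = \big[setI/setT]_(i < n) ((@tnth n T)^~ i @^-1` A i)).
  apply: bigsetI_measurable => i _.
  by rewrite -[X in measurable X]setTI; exact: measurable_tnth.
rewrite -bigcap_seq; apply/seteqP; split=> [x Ax i _|x Ax i]; first exact: Ax.
by apply: (Ax i) => /=; rewrite mem_index_enum.
Qed.

Lemma iid_law_box n (A : 'I_n -> set T) : (forall i, measurable (A i)) ->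
  iid_law n [set x | forall i, A i (tnth x i)] = (\prod_(i < n) P (A i))%E.
Proof.
elim: n A => [A _|n IH A mA] /=.
  by rewrite big_ord0 diracE mem_set// => -[].
rewrite big_ord_recl -IH; last by move=> i; exact: mA.
rewrite /distribution /pushforward /=.
have mB := @measurable_box n (fun i => A (lift ord0 i)) (fun i => mA _).
rewrite -product_measure1E//; congr (_ _).
apply/seteqP; split=> [[x t] /= h|[x t] /= [h0 h] i].
  split; first exact: (h ord0).
  by move=> i; have := h (lift ord0 i); rewrite tnthS.
have [j ->|->//] := unliftP ord0 i.
by rewrite tnthS; exact: h.
Qed.

End iid_law.

Section densities.
Context (R : realType).
Local Notation mu := (@lebesgue_measure R).

(* A density on [0, 1]; its values outside [0, 1] are irrelevant. *)
Record density01 := Density01 {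
  density_fun :> R -> R ;
  _ : measurable_fun (`[0, 1] : set R) density_fun ;
  _ : forall x : R, x \in `[0, 1] -> 0 <= density_fun x ;
  _ : (\int[mu]_(x in `[0%R, 1%R]%classic) (density_fun x)%:E = 1)%E }.

Definition density_ext (f : density01) : R -> R := (f : R -> R) \_ `[0, 1].

Definition density_law (f : density01) (A : set (measurableTypeR R)) : \bar R :=
  (\int[mu]_(x in A) (density_ext f x)%:E)%E.

Section density_law_probability.
Variable f : density01.

Let density_ge0 x : (0 <= (density_ext f x)%:E)%E.
Proof.
rewrite /density_ext; case: f => g _ g0 _ /=; rewrite lee_fin patchE; case: ifPn => //.
by rewrite inE => x01; exact: g0.
Qed.

Let measurable_density :
  measurable_fun [set: R] (density_ext f).
Proof.
rewrite /density_ext; case: f => g mg _ _ /=.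
exact/(measurable_restrictT g (measurable_itv _)).
Qed.

Let density_law0 : density_law f set0 = 0%E.
Proof. exact: integral_set0. Qed.

Let density_law_ge0 A : (0 <= density_law f A)%E.
Proof. by apply: integral_ge0 => x _; exact: density_ge0. Qed.

Let density_law_sigma_additive : semi_sigma_additive (density_law f).
Proof.
apply: (@semi_sigma_additive_nng_induced _ _ _ mu) => //.
exact/measurable_EFinP.
Qed.

HB.instance Definition _ := isMeasure.Build _ _ _ (density_law f)
  density_law0 density_law_ge0 density_law_sigma_additive.

Let density_law_setT : density_law f setT = 1%E.
Proof.
rewrite /density_law /density_ext; case: f => g _ _ g1 /=; rewrite -[RHS]g1.
by rewrite [RHS]integral_mkcond restrict_EFin.
Qed.

HB.instance Definition _ :=
  Measure_isProbability.Build _ _ _ (density_law f) density_law_setT.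

End density_law_probability.

(* Every density is of this form with p = 0. *)
Definition mixture_density (f : density01) : Prop :=
  exists (p : R) (f1 : density01), 0 <= p <= 1 /\
    forall x : R, x \in `[0, 1] -> f x = p + (1 - p) * f1 x.

Section null_law.
Variables (pi0 : R) (pi0_01 : 0 < pi0 <= 1).

Lemma pi0_ge0 : 0 <= pi0.
Proof. by case/andP: pi0_01 => /ltW. Qed.

Lemma onem_pi0_ge0 : 0 <= 1 - pi0.
Proof. by case/andP: pi0_01 => _; rewrite subr_ge0. Qed.

(* pi0 . unif(0, 1) + (1 - pi0) . delta_0 *)
Definition null_law : set (measurableTypeR R) -> \bar R :=
  measure_add
    (mscale (NngNum pi0_ge0) (uniform_prob (@ltr01 R)))
    (mscale (NngNum onem_pi0_ge0) \d_(0 : measurableTypeR R)).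

HB.instance Definition _ := Measure.on null_law.

Lemma null_lawE A : null_law A =
  (pi0%:E * uniform_prob (@ltr01 R) A + (1 - pi0)%:E * \d_(0%R : measurableTypeR R) A)%E.
Proof. by rewrite /null_law measure_addE. Qed.

Let null_law_setT : null_law setT = 1%E.
Proof.
by rewrite null_lawE probability_setT diracT !mule1 -EFinD addrC subrK.
Qed.

HB.instance Definition _ :=
  Measure_isProbability.Build _ _ _ null_law null_law_setT.

End null_law.

End densities.

Section test.
Context (R : realType).
Local Notation pvalues n := (n.-tuple (measurableTypeR R)).

Definition pi_hat n (p : pvalues n) (lambda : R) : R :=
  (n%:R * (1 - lambda))^-1 * \sum_(i < n) (lambda < tnth p i)%R%:R.

(* The set below is nonempty and bounded above by pi0 * sqrt n, and its
   supremum is attained, so [sup] is the maximum. *)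
Definition T_stat (pi0 : R) n (p : pvalues n) : R :=
  sup [set Num.sqrt (n%:R * (1 - lambda)) * (pi0 - pi_hat p lambda)
      | lambda in `[0, 1[ ].

(* The (1 - alpha)-quantile is the generalized inverse of the distribution
   function of T_n(pi0) under the null law. *)
Definition crit_value (pi0 : R) (pi0_01 : 0 < pi0 <= 1) (alpha : R) n : R :=
  inf [set t : R | ((1 - alpha)%:E <=
    iid_law (null_law pi0_01) n [set p | (T_stat pi0 p <= t)%R])%E].

Definition phi (pi0 : R) (pi0_01 : 0 < pi0 <= 1) (alpha : R) n :
    pvalues n -> R :=
  \1_[set p | crit_value pi0_01 alpha n < T_stat pi0 p].

Definition rejection_prob (f : density01 R) n (test : pvalues n -> R) : \bar R :=
  'E_(iid_law (density_law f) n)[test].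

Definition null_hypothesis (pi0 : R) : set (density01 R) :=
  [set f | mixture_density f /\ forall x : R, x \in `[0, 1] -> pi0 <= f x].

Definition has_level (alpha : R) n (test : pvalues n -> R)
    (H0 : set (density01 R)) : Prop :=
  forall f, H0 f -> (rejection_prob f test <= alpha%:E)%E.

Definition Sigma (L beta : R) : set (R -> R) :=
  [set f | forall x x' : R, x \in `[0, 1] -> x' \in `[0, 1] ->
    `|f x - f x'| <= L * `|x - x'| `^ beta].

Definition alt_class (pi0 b L beta : R) : set (density01 R) :=
  [set f | [/\ mixture_density f, f 1 <= pi0 - b & Sigma L beta f]].

(* The infimum over an empty class is 1, whereas [ereal_inf set0] is +oo. *)
Definition min_power n (test : pvalues n -> R) (G : set (density01 R)) :
    \bar R :=
  if `[< G = set0 >] then 1%E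
  else ereal_inf [set rejection_prob f test | f in G].

(* [ln (ln n)] is positive for n >= 3; smaller n give junk values, which the
   limit ignores. *)
Definition rate n (beta : R) : R :=
  (n%:R / ln (ln n%:R)) `^ (- (beta / (2 * beta + 1))).

End test.

(* Main.v *)
(** Level: the rejection region is closed under decreasing p-values, and a law
with density at least pi0 on [0, 1] is stochastically larger than
pi0 unif(0, 1) + (1 - pi0) delta_0.

Power: write u = 1 - lambda and let N(u) count the p-values above 1 - u.  Under
the null law, the Chernoff bound gives sub-Gaussian lower tails for the counts
of dyadic cells; cell number i of its level (counted from the right end 1) is
allowed a deviation proportional to (i + 1)^(1/4), which costs a failure
probability e^(-x) / (i + 1)^2, summable within a level.  With about log n
levels, x of order log log n suffices, and chaining along the dyadic expansion
of u yields n u pi0 - N(u) <= C sqrt(x) sqrt(n u) simultaneously for all u.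
Hence the critical value is O(sqrt(log log n)).  Under the alternative, u is
chosen as (n / log log n)^(-1/(2 beta + 1)), so that the signal
sqrt(n u) u^beta equals sqrt(log log n) for every beta, and one more Chernoff
bound, at this single u, concludes. *)

Require Import Defs.
From mathcomp Require Import all_boot all_order all_algebra.
From mathcomp Require Import all_classical all_reals all_analysis.
From mathcomp Require Import measurable_realfun.
From mathcomp Require Import ring lra.
Import Order.TTheory GRing.Theory Num.Theory.
Import numFieldNormedType.Exports.
Local Open Scope classical_set_scope.
Local Open Scope ring_scope.

Set Implicit Arguments.
Unset Strict Implicit.
Unset Printing Implicit Defensive.

(** * Measurability of sublevel and superlevel sets *)

Section measurable_cst.
Context d (T : measurableType d) (R : realType).

Lemma measurable_le_cst (g : T -> R) (c : R) : measurable_fun setT g ->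
  measurable [set x | g x <= c].
Proof.
move=> mg; rewrite (_ : mkset _ = setT `&` g @^-1` `]-oo, c]); first exact: mg.
by apply/seteqP; split => x /=; rewrite in_itv/= => // -[].
Qed.

Lemma measurable_ge_cst (g : T -> R) (c : R) : measurable_fun setT g ->
  measurable [set x | c <= g x].
Proof.
move=> mg; rewrite (_ : mkset _ = setT `&` g @^-1` `[c, +oo[); first exact: mg.
by apply/seteqP; split => x /=; rewrite in_itv/= andbT => // -[].
Qed.

End measurable_cst.

(** * Exponential moments of i.i.d. counts and the Chernoff bound *)

Section iid_law.
Context d (T : measurableType d) (R : realType).

Lemma iid_lawS (P : probability T R) n (A : set (n.+1.-tuple T)) :
  iid_law P n.+1 A =
  (\int[P]_x iid_law P n (xsection (@tcons _ T n @^-1` A) x))%E.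
Proof. by []. Qed.

Lemma ge0_integral_iid_lawS (P : probability T R) n
    (g : n.+1.-tuple T -> \bar R) :
  measurable_fun setT g -> (forall x, 0 <= g x)%E ->
  (\int[iid_law P n.+1]_x g x =
   \int[P]_x \int[iid_law P n]_t g (tcons (x, t)))%E.
Proof.
move=> mg g0 /=.
rewrite (ge0_integral_pushforward (@measurable_tcons _ T n))//.
rewrite preimage_setT fubini_tonelli1// => [|x]; last exact: g0.
exact: (measurableT_comp mg (@measurable_tcons _ T n)).
Qed.

Lemma measurable_count n (A : set T) : measurable A ->
  measurable_fun setT (fun p : n.-tuple T => \sum_(i < n) \1_A (tnth p i) : R).
Proof.
move=> mA; apply: measurable_sum => i.
exact: (measurableT_comp (measurable_indic mA) (@measurable_tnth _ T n i)).
Qed.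

(** By Tonelli the integral factorises over coordinates; each factor equals
    [1 + q * (expR theta - 1)], and [1 + y <= expR y] bounds it. The sign of [theta] is free, so
    both tails are covered. *)
Lemma integral_expR_count_le (P : probability T R) (A : set T) (q theta : R) n :
  measurable A -> P A = q%:E ->
  (\int[iid_law P n]_p (expR (theta * \sum_(i < n) \1_A (tnth p i)))%:E <=
   (expR (n%:R * (q * (expR theta - 1))))%:E)%E.
Proof.
move=> mA PA; elim: n => [|n IH].
  rewrite integral_dirac//=; last first.
    apply/measurable_EFinP; apply: measurableT_comp => //.
    by apply: measurable_funM => //; exact: measurable_count.
  by rewrite diracT mul1e big_ord0 mulr0 mul0r expR0.
have mE k : measurable_fun setT (fun p : k.-tuple T =>
    (expR (theta * \sum_(i < k) \1_A (tnth p i)))%:E).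
  apply/measurable_EFinP; apply: measurableT_comp => //.
  by apply: measurable_funM => //; exact: measurable_count.
rewrite ge0_integral_iid_lawS; [|exact: mE|by move=> x; rewrite lee_fin expR_ge0].
have mA' : measurable_fun setT (fun x => (expR (theta * \1_A x))%:E : \bar R).
  apply/measurable_EFinP; apply: measurableT_comp => //.
  by apply: measurable_funM => //; exact: measurable_indic.
have H1 : (\int[P]_x (expR (theta * \1_A x))%:E =
           (1 + q * (expR theta - 1))%:E)%E.
  under eq_integral => x _.
    (* Since an indicator only takes the values 0 and 1, its exponential is affine in it. *)
    rewrite (_ : expR _ = 1 + (expR theta - 1) * \1_A x); last first.
      rewrite indicE; case: (x \in A) => /=; rewrite ?mulr1 ?mulr0 ?addr0 ?expR0//.
      by rewrite addrC subrK.
    rewrite EFinD EFinM; over.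
  rewrite integralD//; first last.
  - by apply: integrableZl => //; exact: integrable_indic.
  - exact: finite_measure_integrable_cst.
  rewrite integralZl//; last first.
      exact: integrable_indic.
  rewrite integral_indic// setIT [X in (X + _)%E](integral_cst P measurableT 1).
  by rewrite [X in (_ * X + _)%E](@probability_setT _ _ _ P) mule1 [X in (_ + _ * X)%E]PA -EFinM -EFinD mulrC.
have -> : (\int[P]_x \int[iid_law P n]_t
     (expR (theta * \sum_(i < n.+1) \1_A (tnth (tcons (x, t)) i)))%:E =
   \int[P]_x ((expR (theta * \1_A x))%:E *
     \int[iid_law P n]_t (expR (theta * \sum_(i < n) \1_A (tnth t i)))%:E))%E.
  apply: eq_integral => x _; rewrite -ge0_integralZl; first last.
  - by rewrite lee_fin expR_ge0.
  - by move=> t _; rewrite lee_fin expR_ge0.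
  - exact: mE.
  - exact: measurableT.
  apply: eq_integral => t _; rewrite big_ord_recl mulrDr expRD EFinM; congr (_ * _)%E.
  congr (expR (_ * _))%:E; apply: eq_bigr => i _.
  by rewrite tnthS.
have e0 : (0 <= \int[iid_law P n]_t (expR (theta * \sum_(i < n) \1_A (tnth t i)))%:E)%E.
  by apply: integral_ge0 => t _; rewrite lee_fin expR_ge0.
rewrite ge0_integralZr//.
have h0 : 0 <= 1 + q * (expR theta - 1).
  rewrite -lee_fin -H1; apply: integral_ge0 => x _; rewrite lee_fin expR_ge0//.
rewrite H1; apply: (@le_trans _ _ ((1 + q * (expR theta - 1))%:E *
   (expR (n%:R * (q * (expR theta - 1))))%:E)%E).
  exact: lee_wpmul2l.
rewrite -EFinM lee_fin -natr1 (mulrDl n%:R 1) mul1r expRD mulrC ler_wpM2l ?expR_ge0//.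
exact: expR_ge1Dx.
Qed.

(** Markov's inequality for the exponential moment. Keeping [theta] inside the event lets a negative
    [theta] give the lower tail and a positive one the upper tail. *)
Lemma iid_law_chernoff (P : probability T R) (A : set T) (q theta y : R) n :
  measurable A -> P A = q%:E ->
  (iid_law P n [set p | (y <= theta * \sum_(i < n) \1_A (tnth p i))%R] <=
   (expR (n%:R * (q * (expR theta - 1)) - y))%:E)%E.
Proof.
move=> mA PA.
have mc : measurable_fun setT (fun p : n.-tuple T =>
    theta * \sum_(i < n) \1_A (tnth p i)).
  by apply: measurable_funM => //; exact: measurable_count.
set B := [set p | _].
have mB : measurable B by exact: measurable_ge_cst.
rewrite addrC expRD EFinM; apply: (@le_trans _ _ ((expR (- y))%:E *
    \int[iid_law P n]_p (expR (theta * \sum_(i < n) \1_A (tnth p i)))%:E)%E);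
  last by apply: lee_wpmul2l; [rewrite lee_fin expR_ge0|exact: integral_expR_count_le].
have mE : measurable_fun setT (fun p : n.-tuple T =>
    (expR (theta * \sum_(i < n) \1_A (tnth p i)))%:E).
  by apply/measurable_EFinP; exact: measurableT_comp.
rewrite -ge0_integralZl; first last.
- by rewrite lee_fin expR_ge0.
- by move=> p _; rewrite lee_fin expR_ge0.
- exact: mE.
- exact: measurableT.
rewrite -(setIT B) -integral_indic//; apply: ge0_le_integral => //.
- by apply/measurable_EFinP; exact: measurable_indic.
- exact: measurable_funeM.
move=> p _; rewrite -EFinM lee_fin -expRD indicE.
case: (boolP (p \in B)) => [|_]; last exact: expR_ge0.
by rewrite inE => pB; rewrite -expR0 ler_expR addrC subr_ge0.
Qed.

End iid_law.

(** * Stochastic dominance passes to i.i.d. samples *)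

Section dominance.
Context (R : realType).
Local Notation T := (measurableTypeR R).

(** The law is exchanged one coordinate at a time: sections of a down-closed set are down-closed, so
    the induction hypothesis replaces the tail with the head fixed, and [PQ] then replaces the head
    with the tail fixed. *)
Lemma iid_law_dominance (P Q : probability T R) :
  (forall D : set T, measurable D ->
     (forall x y : R, y <= x -> D x -> D y) -> (P D <= Q D)%E) ->
  forall n (A : set (n.-tuple T)), measurable A ->
    (forall p p' : n.-tuple T, (forall i, (tnth p' i <= tnth p i :> R)) ->
       A p -> A p') ->
    (iid_law P n A <= iid_law Q n A)%E.
Proof.
move=> PQ; elim=> [//|n IH] A mA dA.
set B := @tcons _ T n @^-1` A.
have mB : measurable B.
  by rewrite -[B]setTI; exact: (@measurable_tcons _ T n).
have le_tcons (x y : R) (s t : n.-tuple T) : y <= x ->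
    (forall i, (tnth t i <= tnth s i :> R)) ->
    forall i, (tnth (tcons (y, t)) i <= tnth (tcons (x, s)) i :> R).
  move=> yx ts i; have [j ->|->//] := unliftP ord0 i.
  by rewrite !tnthS.
rewrite !iid_lawS -/B.
apply: (@le_trans _ _ (\int[P]_x iid_law Q n (xsection B x))%E).
  apply: ge0_le_integral => //.
  - exact: measurable_fun_xsection.
  - exact: measurable_fun_xsection.
  move=> x _; apply: IH; first exact: measurable_xsection.
  move=> p p' pp'; rewrite /xsection/= !inE; apply: dA.
  exact: le_tcons.
(* The order of integration is exchanged through uniqueness of the product measure. *)
have swap (P' : probability T R) : (\int[P']_x iid_law Q n (xsection B x) =
    \int[iid_law Q n]_t P' (ysection B t))%E.
  rewrite -[RHS]/(product_measure2 P' (iid_law Q n) B).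
  rewrite -[LHS]/(product_measure1 P' (iid_law Q n) B).
  apply: product_measure_unique => // C D mC mD.
  exact: product_measure2E.
rewrite !swap; apply: ge0_le_integral => //.
- exact: measurable_fun_ysection.
- exact: measurable_fun_ysection.
move=> t _; apply: PQ; first exact: measurable_ysection.
move=> x y yx; rewrite /ysection/= !inE; apply: dA.
exact: le_tcons.
Qed.

End dominance.

(** * The statistic: bounds, measurability and monotonicity *)

Section statistic.
Context (R : realType).
Local Notation T := (measurableTypeR R).

Lemma indic_itvoy (a y : R) :
  \1_(`]a, +oo[%classic : set T) y = (a < y)%R%:R :> R.
Proof.
rewrite indicE; congr (_%:R); congr nat_of_bool.
by apply/idP/idP; rewrite inE/= in_itv/= andbT.
Qed.

(** Written with set indicators, the form to which the Chernoff bound applies. *)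
Definition tail_count n (p : n.-tuple T) (lambda : R) : R :=
  \sum_(i < n) \1_(`]lambda, +oo[%classic : set T) (tnth p i).

Definition scaled_gap (pi0 : R) n (p : n.-tuple T) (lambda : R) : R :=
  Num.sqrt (n%:R * (1 - lambda)) * (pi0 - pi_hat p lambda).

Lemma pi_hatE n (p : n.-tuple T) lambda :
  pi_hat p lambda = (n%:R * (1 - lambda))^-1 * tail_count p lambda.
Proof.
by rewrite /pi_hat; congr (_ * _); apply: eq_bigr => i _; rewrite indic_itvoy.
Qed.

Lemma tail_count_ge0 n (p : n.-tuple T) lambda : 0 <= tail_count p lambda.
Proof. by apply: sumr_ge0 => i _; rewrite indicE. Qed.

Lemma le_tail_count n (p p' : n.-tuple T) (lambda : R) :
  (forall i, tnth p' i <= tnth p i :> R) ->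
  tail_count p' lambda <= tail_count p lambda.
Proof.
move=> pp'; apply: ler_sum => i _; rewrite !indicE ler_nat.
case: (boolP (tnth p' i \in _)) => //.
rewrite inE/= in_itv/= andbT => lp.
by rewrite mem_set//= in_itv/= andbT (lt_le_trans lp).
Qed.

Lemma tail_count_le n (p : n.-tuple T) (lambda mu : R) :
  lambda <= mu -> tail_count p mu <= tail_count p lambda.
Proof.
move=> lm; apply: ler_sum => i _; rewrite !indicE ler_nat.
case: (boolP (tnth p i \in _)) => //.
rewrite inE/= in_itv/= andbT => lp.
by rewrite mem_set//= in_itv/= andbT (le_lt_trans lm).
Qed.

Lemma scaled_gapE (pi0 : R) n (p : n.-tuple T) lambda : lambda < 1 ->
  scaled_gap pi0 p lambda =
  (n%:R * (1 - lambda) * pi0 - tail_count p lambda) /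
    Num.sqrt (n%:R * (1 - lambda)).
Proof.
move=> l1; rewrite /scaled_gap pi_hatE.
(* For [n = 0] both sides vanish, because the inverse of 0 is 0. *)
have [n0|n0] := posnP n.
  by rewrite (_ : n%:R = 0) ?n0// !mul0r sqrtr0 !mul0r invr0 mulr0.
have w0 : 0 < n%:R * (1 - lambda) by rewrite mulr_gt0 ?ltr0n ?subr_gt0.
set w := _ * _ in w0 *.
have sw0 : Num.sqrt w != 0 by rewrite gt_eqF ?sqrtr_gt0.
rewrite -{2 3}(sqr_sqrtr (ltW w0)); field.
exact: sw0.
Qed.

Lemma scaled_gap_le (pi0 : R) n (p : n.-tuple T) lambda : 0 <= pi0 <= 1 ->
  scaled_gap pi0 p lambda <= Num.sqrt (n%:R * (1 - lambda)).
Proof.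
move=> /andP[pi00 pi01]; have [l1|l1] := ltP lambda 1.
  rewrite -[leRHS]mulr1 ler_wpM2l ?sqrtr_ge0// (le_trans _ pi01)//.
  rewrite gerBl pi_hatE mulr_ge0 ?tail_count_ge0//.
  by rewrite invr_ge0 mulr_ge0// subr_ge0 ltW.
(* For [lambda >= 1] the radicand is nonpositive, so its square root is 0 by convention. *)
rewrite /scaled_gap ler0_sqrtr ?mul0r//.
by rewrite mulr_ge0_le0// subr_le0.
Qed.

Section sup.
Context (pi0 : R) (pi0_01 : 0 < pi0 <= 1).

Let pi0_01' : 0 <= pi0 <= 1.
Proof. by case/andP: pi0_01 => /ltW -> ->. Qed.

Lemma has_ubound_scaled_gap n (p : n.-tuple T) :
  has_ubound [set scaled_gap pi0 p l | l in `[0, 1[ ].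
Proof.
exists (Num.sqrt n%:R) => _ [l /= + <-]; rewrite in_itv/= => /andP[l0 l1].
apply: (le_trans (scaled_gap_le _ _ pi0_01')).
by rewrite ler_wsqrtr// ler_piMr// gerBl.
Qed.

Lemma scaled_gap_nonempty n (p : n.-tuple T) :
  [set scaled_gap pi0 p l | l in `[0, 1[ ] !=set0.
Proof. by exists (scaled_gap pi0 p 0), 0 => //=; rewrite in_itv/= lexx ltr01. Qed.

Lemma T_stat_ge n (p : n.-tuple T) l : 0 <= l < 1 ->
  scaled_gap pi0 p l <= T_stat pi0 p.
Proof.
move=> l01; apply: (ub_le_sup (has_ubound_scaled_gap p)).
by exists l => //=; rewrite in_itv.
Qed.

Lemma T_stat_le n (p : n.-tuple T) t :
  (forall l, 0 <= l < 1 -> scaled_gap pi0 p l <= t) -> T_stat pi0 p <= t.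
Proof.
move=> gt; apply: ge_sup; first exact: scaled_gap_nonempty.
by move=> _ [l /= + <-]; rewrite in_itv/=; exact: gt.
Qed.

Lemma T_stat_gtP n (p : n.-tuple T) t :
  t < T_stat pi0 p <-> exists2 l, 0 <= l < 1 & t < scaled_gap pi0 p l.
Proof.
split=> [tT|[l l01 tl]]; last exact: lt_le_trans (T_stat_ge _ l01).
apply: contrapT => h; move: tT; apply/negP; rewrite -leNgt.
apply: T_stat_le => l l01; rewrite leNgt; apply/negP => tl.
by apply: h; exists l.
Qed.

(** The inequality [lambda < p_i] is strict, so each indicator is constant just to the right of any
    point. *)
Lemma near_right_tail_count n (p : n.-tuple T) (l : R) :
  \forall mu \near l^'+, tail_count p mu = tail_count p l.
Proof.
have H : \forall mu \near l^'+, forall i : 'I_n,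
    \1_(`]mu, +oo[%classic : set T) (tnth p i) =
    \1_(`]l, +oo[%classic : set T) (tnth p i) :> R.
  apply: filter_forall => i.
  have [lp|pl] := ltP l (tnth p i).
    near=> mu; rewrite !indic_itvoy lp.
    by rewrite (_ : mu < _)//; near: mu; exact: nbhs_right_lt.
  near=> mu; have lmu : l <= mu by near: mu; exact: nbhs_right_ge.
  by rewrite !indic_itvoy !ltNge pl (le_trans pl lmu).
apply: filterS H => mu H; apply: eq_bigr => i _; exact: H.
Unshelve. all: by end_near. Qed.

Lemma near_right_scaled_gap n (p : n.-tuple T) (l t : R) : l < 1 ->
  t < scaled_gap pi0 p l -> \forall mu \near l^'+, t < scaled_gap pi0 p mu.
Proof.
move=> l1.
have [n0|n0] := posnP n.
  have nR : n%:R = 0 :> R by rewrite n0.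
  rewrite /scaled_gap nR !mul0r sqrtr0 mul0r => t0; near=> mu.
  by rewrite mul0r sqrtr0 mul0r.
have w0 : 0 < n%:R * (1 - l) by rewrite mulr_gt0 ?ltr0n ?subr_gt0.
rewrite /scaled_gap pi_hatE => tg.
have H : (fun mu : R => Num.sqrt (n%:R * (1 - mu)) *
   (pi0 - (n%:R * (1 - mu))^-1 * tail_count p l)) @ l^'+ -->
   Num.sqrt (n%:R * (1 - l)) * (pi0 - (n%:R * (1 - l))^-1 * tail_count p l).
  apply: cvg_at_right_filter.
  have cw : (fun mu : R => n%:R * (1 - mu)) @ l --> n%:R * (1 - l).
    by apply: cvgM; [exact: cvg_cst|apply: cvgB; [exact: cvg_cst|exact: cvg_id]].
  apply: cvgM.
    exact: (cvg_comp _ _ cw (@sqrt_continuous R _)).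
  apply: cvgB; first exact: cvg_cst.
  apply: cvgM; last exact: cvg_cst.
  by apply: cvgV => //; rewrite gt_eqF.
have := cvgr_gt _ H _ tg => H'.
near=> mu; have tE : tail_count p mu = tail_count p l.
  by near: mu; exact: near_right_tail_count.
by rewrite pi_hatE tE; near: mu; exact: H'.
Unshelve. all: by end_near. Qed.

(** The gap is right-continuous in [lambda], so a value above [t] persists at some rational point to
    the right. The uncountable union over [lambda] thus reduces to a countable one. *)
Lemma measurable_T_stat_gt n t :
  measurable [set p : n.-tuple T | t < T_stat pi0 p].
Proof.
pose F (q : rat) := [set p : n.-tuple T | 0 <= (ratr q : R) < 1 /\ t < scaled_gap pi0 p (ratr q)].
rewrite (_ : [set p | _] = \bigcup_q F q).
  apply: bigcupT_measurable_rat => q.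
  rewrite /F; have [q01|q01] := boolP (0 <= (ratr q : R) < 1); last first.
    by rewrite (_ : mkset _ = set0)//; apply/seteqP; split => // p [].
  rewrite (_ : mkset _ = setT `&`
    (fun p : n.-tuple T => scaled_gap pi0 p (ratr q)) @^-1` `]t, +oo[); last first.
    by apply/seteqP; split => p /=; rewrite in_itv/= andbT => -[].
  suff : measurable_fun setT (fun p : n.-tuple T => scaled_gap pi0 p (ratr q)) by exact.
  rewrite /scaled_gap; under eq_fun do rewrite pi_hatE.
  apply: measurable_funM => //; apply: measurable_funB => //.
  apply: measurable_funM => //.
  exact: measurable_count.
apply/seteqP; split => [p /=|p [q _ [q01 tq]]]; last by apply/T_stat_gtP; exists (ratr q).
move=> /T_stat_gtP[l /andP[l0 l1] tl].
have H : \forall mu \near l^'+, t < scaled_gap pi0 p mu /\ mu < 1.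
  near=> mu; split; near: mu; first exact: near_right_scaled_gap.
  exact: nbhs_right_lt.
have [e /= e0 He] := H.
have /rat_in_itvoo[q] : l < l + e by rewrite ltrDl.
rewrite in_itv/= => /andP[lq qe].
have [||tq q1] := He (ratr q); first 2 last.
- by exists q => //; rewrite /F/= q1 tq (le_trans l0 (ltW lq)).
- by rewrite /ball_/= ltr0_norm ?subr_lt0// opprB ltrBlDl.
- exact: lq.
Unshelve. all: by end_near. Qed.

Lemma T_stat_gt_down_closed n t (p p' : n.-tuple T) :
  (forall i, (tnth p' i <= tnth p i :> R)) ->
  t < T_stat pi0 p -> t < T_stat pi0 p'.
Proof.
move=> pp' /T_stat_gtP[l /andP[l0 l1] tl]; apply/T_stat_gtP; exists l.
  by rewrite l0.
apply: (lt_le_trans tl); rewrite !scaled_gapE// ler_wpM2r ?invr_ge0 ?sqrtr_ge0//.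
by rewrite lerD2l lerN2 le_tail_count.
Qed.

Lemma T_stat_sqrt_le n (p : n.-tuple T) : T_stat pi0 p <= Num.sqrt n%:R.
Proof.
apply: T_stat_le => l /andP[l0 l1].
apply: (le_trans (scaled_gap_le _ _ pi0_01')).
by rewrite ler_wsqrtr// ler_piMr// gerBl.
Qed.

Lemma T_stat_ge_Nsqrt n (p : n.-tuple T) : - Num.sqrt n%:R <= T_stat pi0 p.
Proof.
have := @T_stat_ge n p 0; rewrite lexx ltr01 => /(_ isT); apply: le_trans.
rewrite /scaled_gap pi_hatE subr0 mulr1 -mulrN1 ler_wpM2l ?sqrtr_ge0//.
case/andP: pi0_01' => pi00 _.
have : n%:R^-1 * tail_count p 0 <= 1; last by lra.
have [n0|n0] := posnP n; first by rewrite (_ : n%:R = 0) ?n0// invr0 mul0r.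
rewrite ler_pdivrMl ?ltr0n// mulr1.
rewrite (_ : n%:R = \sum_(i < n) 1); last by rewrite sumr_const card_ord.
by apply: ler_sum => i _; rewrite indicE lern1 leq_b1.
Qed.

End sup.

End statistic.

(** * The level of the test *)

Section level.
Context (R : realType) (pi0 alpha : R) (pi0_01 : 0 < pi0 <= 1)
  (alpha_01 : 0 < alpha < 1).
Local Notation T := (measurableTypeR R).

Local Notation Q n := (iid_law (null_law pi0_01) n).

Lemma measurable_T_stat_le n t :
  measurable [set p : n.-tuple T | T_stat pi0 p <= t].
Proof.
rewrite (_ : mkset _ = ~` [set p | t < T_stat pi0 p]).
  by apply: measurableC; exact: measurable_T_stat_gt.
by apply/seteqP; split => p /=; [move/le_gtF/negP|move/negP; rewrite -leNgt].
Qed.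

Let crit_set n := [set t : R | ((1 - alpha)%:E <=
    Q n [set p | (T_stat pi0 p <= t)%R])%E].

Let has_lbound_crit_set n : has_lbound (crit_set n).
Proof.
exists (- Num.sqrt n%:R) => t /=; rewrite leNgt /crit_set/=.
move=> h; apply/negP => tn; move: h; apply/negP; rewrite -ltNge.
rewrite (_ : mkset _ = set0).
  by rewrite measure0 lte_fin; case/andP: alpha_01; lra.
apply/seteqP; split => // p /= pt.
by have := T_stat_ge_Nsqrt pi0_01 p; rewrite leNgt (le_lt_trans pt).
Qed.

Let crit_set_nonempty n : crit_set n !=set0.
Proof.
exists (Num.sqrt n%:R); rewrite /crit_set/= (_ : mkset _ = setT).
  by rewrite probability_setT lee_fin; case/andP: alpha_01; lra.
by apply/seteqP; split => // p _ /=; exact: T_stat_sqrt_le.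
Qed.

Lemma crit_value_le n t :
  ((1 - alpha)%:E <= Q n [set p | (T_stat pi0 p <= t)%R])%E ->
  crit_value pi0_01 alpha n <= t.
Proof. by move=> h; apply: ge_inf => //; exact: has_lbound_crit_set. Qed.

(** The infimum defining the critical value need not be known to be attained: the event is the
    increasing union of [c + 1/(k+1) < T_stat]. Each of these has probability at most [alpha], since
    some admissible [t] lies below [c + 1/(k+1)]; continuity from below concludes. *)
Lemma null_T_stat_gt_crit n :
  (Q n [set p | (crit_value pi0_01 alpha n < T_stat pi0 p)%R] <= alpha%:E)%E.
Proof.
set c := crit_value _ _ _.
pose F k := [set p : n.-tuple T | c + k.+1%:R^-1 < T_stat pi0 p].
have FE : [set p | c < T_stat pi0 p] = \bigcup_k F k.
  apply/seteqP; split => [p /= cT|p [k _] /=]; last first.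
    by apply: le_lt_trans; rewrite lerDl.
  have : 0 < T_stat pi0 p - c by rewrite subr_gt0.
  move=> /ltr_add_invr[k]; rewrite add0r => hk; exists k => //.
  by rewrite /F/= -ltrBrDl.
have mF k : measurable (F k) by exact: measurable_T_stat_gt.
have H : (Q n \o F) @ \oo --> Q n (\bigcup_k F k).
  apply: nondecreasing_cvg_mu => //.
    exact: bigcup_measurable.
  move=> k m km; apply/subsetPset => p; apply: le_lt_trans.
  by rewrite lerD2l lef_pV2 ?posrE// ler_nat ltnS.
rewrite FE -(cvg_lim _ H)//; apply: lime_le.
  by apply/cvg_ex; eexists; exact: H.
apply: nearW => k /=.
have : inf (crit_set n) < c + k.+1%:R^-1 by rewrite ltrDl.
move=> /(inf_lt (crit_set_nonempty n))[t]; rewrite /crit_set/= => ht tc.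
apply: (@le_trans _ _ (Q n (~` [set p | T_stat pi0 p <= t]))).
  apply: le_measure; rewrite ?inE//.
    by apply: measurableC; exact: measurable_T_stat_le.
  by move=> p /= /(lt_trans tc); rewrite ltNge => /negP.
rewrite probability_setC; last exact: measurable_T_stat_le.
move: ht; rewrite -(@fineK _ (Q n _)) ?fin_num_measure//; last exact: measurable_T_stat_le.
by rewrite lee_fin -EFinB lee_fin; lra.
Qed.

Lemma rejection_probE (f : density01 R) n :
  rejection_prob f (phi pi0_01 alpha (n := n)) =
  iid_law (density_law f) n [set p | crit_value pi0_01 alpha n < T_stat pi0 p].
Proof.
rewrite /rejection_prob unlock /phi integral_indic ?setIT//.
exact: measurable_T_stat_gt.
Qed.

Lemma density_lawE (f : density01 R) (A : set T) :
  density_law f A = (\int[lebesgue_measure]_(x in A `&` `[0%R, 1%R]) (f x)%:E)%E.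
Proof.
rewrite /density_law integral_mkcondr; apply: eq_integral => x _.
by rewrite /density_ext !patchE; case: ifPn.
Qed.

Lemma uniform_prob01E (A : set T) : measurable A ->
  uniform_prob (@ltr01 R) A = lebesgue_measure (A `&` `[0%R, 1%R]).
Proof.
move=> mA; rewrite /uniform_prob integral_uniform_pdf.
rewrite (eq_integral (fun=> 1%E)).
  rewrite integral_cst ?mul1e//.
  by apply: measurableI => //; exact: measurable_itv.
move=> x; rewrite inE/= => -[_]; rewrite in_itv/= => x01.
by rewrite /uniform_pdf x01 subr0 invr1.
Qed.

Lemma density_measurable (f : density01 R) (A : set T) : measurable A ->
  measurable_fun (A `&` `[0, 1]) (fun x => (f x)%:E).
Proof.
move=> mA; have mf : measurable_fun (`[0, 1]%classic : set R) f by case: f.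
apply/measurable_EFinP.
exact: (measurable_funS (measurable_itv _) (@subIsetr _ _ _) mf).
Qed.

Lemma density_ge0 (f : density01 R) (x : R) : x \in `[0, 1] -> 0 <= f x.
Proof. by case: f => g ? h ? /=; exact: h. Qed.

(** A down-closed [D] missing 0 misses all of [0, 1]. Otherwise the complement avoids the atom at 0,
    so its null mass is [pi0] times its Lebesgue measure inside [0, 1], which is at most its mass
    under [f]. *)
Lemma null_law_dominance (f : density01 R) : null_hypothesis pi0 f ->
  forall D : set T, measurable D -> (forall x y : R, y <= x -> D x -> D y) ->
  (density_law f D <= null_law pi0_01 D)%E.
Proof.
move=> [_ fpi0] D mD downD.
have [D0|D0] := pselect (D 0); last first.
  rewrite density_lawE (_ : D `&` _ = set0) ?integral_set0//.
  apply/seteqP; split => // x [Dx] /=; rewrite in_itv/= => /andP[x0 _].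
  by apply: D0; exact: downD x0 Dx.
have mDC := measurableC mD.
rewrite -(setCK D) (probability_setC (density_law f) mDC).
rewrite (probability_setC (null_law pi0_01) mDC); apply: leeB => //.
rewrite -[X in (X <= _)%E]/(null_law pi0_01 (~` D)) null_lawE diracE memNset//= mule0 adde0 uniform_prob01E// density_lawE.
have mDI : measurable (~` D `&` `[0, 1]%classic : set T).
  by apply: measurableI => //; exact: measurable_itv.
rewrite -integral_cst//; apply: ge0_le_integral => //.
- by move=> x _; rewrite lee_fin pi0_ge0.
- exact: density_measurable.
- by move=> x [_] x01; rewrite lee_fin; exact: fpi0.
Qed.

Lemma phi_has_level n :
  has_level alpha (phi pi0_01 alpha (n := n)) (null_hypothesis pi0).
Proof.
move=> f H0f; rewrite rejection_probE.
apply: le_trans (null_T_stat_gt_crit n).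
apply: iid_law_dominance; first exact: null_law_dominance.
  exact: measurable_T_stat_gt.
by move=> p p'; exact: T_stat_gt_down_closed.
Qed.

End level.

(** * Quadratic bounds on the exponential and tails of binomial counts *)

Section expR_bounds.
Context (R : realType).
Implicit Types x : R.

Lemma expRN_le_quadratic x : 0 <= x -> expR (- x) <= 1 - x + x ^+ 2.
Proof.
move=> x0; rewrite expRN; apply: (@le_trans _ _ (1 + x)^-1).
  by rewrite lef_pV2 ?posrE ?expR_gt0 ?expR_ge1Dx//; lra.
rewrite -[leLHS]mul1r ler_pdivrMr; last by lra.
have : 0 <= x ^+ 3 by rewrite exprn_ge0.
by rewrite !exprS expr0; nra.
Qed.

Lemma expR_le_quadratic x : 0 <= x <= 2^-1 -> expR x <= 1 + x + 2 * x ^+ 2.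
Proof.
move=> /andP[x0 x1]; rewrite -[x in expR x]opprK expRN.
apply: (@le_trans _ _ (1 - x)^-1).
  by rewrite lef_pV2 ?posrE ?expR_gt0 ?expR_ge1Dx//; lra.
rewrite -[leLHS]mul1r ler_pdivrMr; last by lra.
by nra.
Qed.

End expR_bounds.

Section binomial_tails.
Context d (T : measurableType d) (R : realType) (P : probability T R).
Variables (A : set T) (q : R) (mA : measurable A) (PA : P A = q%:E).

Let q_ge0 : 0 <= q.
Proof. by rewrite -lee_fin -PA. Qed.

(** Chernoff at [theta = - e]. After the quadratic bound the exponent is at most [n v e^2 - e t],
    which [e = t / (2 n v)] minimises. Here [v] is any convenient upper bound for [q]. *)
Lemma iid_law_lower_tail n (v t : R) : q <= v -> 0 < n%:R * v -> 0 <= t ->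
  (iid_law P n [set p | (\sum_(i < n) \1_A (tnth p i) <= n%:R * q - t)%R] <=
   (expR (- (t ^+ 2 / (4 * (n%:R * v)))))%:E)%E.
Proof.
move=> qv nv0 t0.
set e := t / (2 * (n%:R * v)).
have e0 : 0 <= e by rewrite divr_ge0// mulr_ge0// ltW.
set y := - e * (n%:R * q - t).
apply: (@le_trans _ _
    (iid_law P n [set p | (y <= - e * \sum_(i < n) \1_A (tnth p i))%R])).
  have mc : measurable_fun setT (fun p : n.-tuple T =>
      \sum_(i < n) \1_A (tnth p i) : R) by exact: measurable_count.
  apply: le_measure; rewrite ?inE.
  - exact: measurable_le_cst.
  - by apply: measurable_ge_cst; exact: measurable_funM.
  - by move=> p /= h; rewrite /y !mulNr lerN2 ler_wpM2l.
apply: (le_trans (iid_law_chernoff _ _ _ mA PA)).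
rewrite lee_fin ler_expR.
have nq : n%:R * q <= n%:R * v by rewrite ler_wpM2l.
have nq0 : 0 <= n%:R * q by rewrite mulr_ge0.
have E := expRN_le_quadratic e0.
have -> : t ^+ 2 / (4 * (n%:R * v)) = e * t - (n%:R * v) * e ^+ 2.
  by rewrite /e; field; rewrite andbC -negb_or -mulf_eq0 gt_eqF.
rewrite /y mulrA; set a := n%:R * q in nq nq0 *.
have : a * (expR (- e) - 1) <= a * (- e + e ^+ 2) by rewrite ler_wpM2l//; lra.
have : a * e ^+ 2 <= n%:R * v * e ^+ 2 by rewrite ler_wpM2r// sqr_ge0.
by set w := expR _; lra.
Qed.

(** Here [theta] is fixed at [1 / (2 sqrt (n v))], independently of [t]; the hypothesis [1 <= n v]
    keeps it below 1/2, where the quadratic bound holds. The decay is only exponential in [t], which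
    is enough for the power. *)
Lemma iid_law_upper_tail n (v t : R) : q <= v -> 1 <= n%:R * v ->
  (iid_law P n [set p | (n%:R * q + Num.sqrt (n%:R * v) * t <=
                         \sum_(i < n) \1_A (tnth p i))%R] <=
   (expR ((1 - t) / 2))%:E)%E.
Proof.
move=> qv nv1; set w := Num.sqrt (n%:R * v).
have nv0 : 0 <= n%:R * v by rewrite (le_trans _ nv1).
have w1 : 1 <= w by rewrite -sqrtr1 ler_wsqrtr.
have w0 : 0 < w by rewrite (lt_le_trans _ w1).
set e := (2 * w)^-1.
have e0 : 0 <= e <= 2^-1.
  by rewrite invr_ge0 mulr_ge0 ?(ltW w0)//= lef_pV2 ?posrE ?mulr_gt0//; lra.
have ege0 : 0 <= e by case/andP: e0.
apply: (@le_trans _ _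
    (iid_law P n [set p | (e * (n%:R * q + w * t) <=
       e * \sum_(i < n) \1_A (tnth p i))%R])).
  have mc : measurable_fun setT (fun p : n.-tuple T =>
      \sum_(i < n) \1_A (tnth p i) : R) by exact: measurable_count.
  apply: le_measure; rewrite ?inE.
  - exact: measurable_ge_cst.
  - by apply: measurable_ge_cst; exact: measurable_funM.
  - by move=> p /= h; rewrite ler_wpM2l.
apply: (le_trans (iid_law_chernoff _ _ _ mA PA)).
rewrite lee_fin ler_expR mulrA.
have nq : n%:R * q <= n%:R * v by rewrite ler_wpM2l.
have nq0 : 0 <= n%:R * q by rewrite mulr_ge0.
have E := expR_le_quadratic e0.
set a := n%:R * q in nq nq0 *.
have H1 : a * (expR e - 1) <= a * (e + 2 * e ^+ 2) by rewrite ler_wpM2l//; lra.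
have H2 : a * e ^+ 2 <= n%:R * v * e ^+ 2 by rewrite ler_wpM2r// sqr_ge0.
have H3 : n%:R * v * e ^+ 2 = 4^-1.
  by rewrite -(sqr_sqrtr nv0) -/w /e; field; rewrite gt_eqF.
have H4 : e * (w * t) = t / 2 by rewrite /e; field; rewrite gt_eqF.
rewrite (mulrDr e) H4; move: H1 H2; rewrite H3; set z := expR _; lra.
Qed.

End binomial_tails.

(** * Chaining: the upper tail of the statistic under the null law *)

Section null_tail.
Context (R : realType) (pi0 : R) (pi0_01 : 0 < pi0 <= 1).
Local Notation T := (measurableTypeR R).

Lemma null_law_itv (a b : R) : 0 <= a -> a <= b -> b <= 1 ->
  null_law pi0_01 (`]a, b]%classic : set T) = (pi0 * (b - a))%:E.
Proof.
move=> a0 ab b1; rewrite null_lawE diracE memNset/=; last first.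
  by rewrite in_itv/= ltNge a0.
rewrite mule0 adde0 uniform_prob01E; last exact: measurable_itv.
rewrite (_ : _ `&` _ = `]a, b]%classic); last first.
  apply/seteqP; split => [x []//|x /=]; rewrite !in_itv/= => /andP[ax xb].
  by rewrite ax xb (le_trans a0 (ltW ax)) (le_trans xb b1).
rewrite lebesgue_measure_itv/= lte_fin; case: ltP => [_|ba]; first by rewrite EFinM.
by rewrite mule0 (_ : b = a) ?subrr ?mulr0//; apply/eqP; rewrite eq_le ba.
Qed.

(* The correction 14 i^(1/4) absorbs the deviation (2i + 1)^(1/4) of a new cell,
   since 15 * 3^(1/4) <= 14 * sqrt 2. *)
Definition chain_weight (i : nat) : R :=
  15 * Num.sqrt i%:R - 14 * Num.sqrt (Num.sqrt i%:R).

Let sqrt2_ge1 : 1 <= Num.sqrt (2 : R).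
Proof. by rewrite -[leLHS]sqrtr1 ler_wsqrtr// ler1n. Qed.

(** Doubling [i] multiplies the correction term by only [2^(1/4)], less than [sqrt 2]. *)
Lemma chain_weight_double i :
  Num.sqrt 2 * chain_weight i <= chain_weight i.*2.
Proof.
have h0 : Num.sqrt (Num.sqrt 2) <= Num.sqrt 2 :> R.
  by rewrite ler_wsqrtr// -[leRHS]sqr_sqrtr// expr2 ler_peMr ?sqrtr_ge0.
rewrite /chain_weight -muln2 mulnC natrM !sqrtrM ?sqrtr_ge0//.
have := sqrtr_ge0 (Num.sqrt i%:R : R).
move: (Num.sqrt (Num.sqrt i%:R)) => a a0.
by have := ler_wpM2r a0 h0; lra.
Qed.

Lemma chain_weight_doubleS i :
  Num.sqrt 2 * chain_weight i + Num.sqrt (Num.sqrt i.*2.+1%:R) <=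
  chain_weight i.*2.+1.
Proof.
rewrite /chain_weight.
have r1 := sqrt2_ge1; have r2 : Num.sqrt (2 : R) ^+ 2 = 2 by rewrite sqr_sqrtr.
move: (Num.sqrt 2) r1 r2 => r r1 r2.
have aE : Num.sqrt (Num.sqrt (i%:R : R)) ^+ 2 = Num.sqrt i%:R.
  by rewrite sqr_sqrtr ?sqrtr_ge0.
have iE : Num.sqrt (i%:R : R) ^+ 2 = i%:R by rewrite sqr_sqrtr.
have yE : Num.sqrt (Num.sqrt (i.*2.+1%:R : R)) ^+ 2 = Num.sqrt i.*2.+1%:R.
  by rewrite sqr_sqrtr ?sqrtr_ge0.
have jE : Num.sqrt (i.*2.+1%:R : R) ^+ 2 = 2 * i%:R + 1.
  by rewrite sqr_sqrtr// -natr1 -muln2 natrM mulrC.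
have a0 := sqrtr_ge0 (Num.sqrt (i%:R : R)).
have y0 := sqrtr_ge0 (Num.sqrt (i.*2.+1%:R : R)).
(* For [i = 0] the inequality is an equality, as 15 - 14 = 1. *)
have [i0|i0] := posnP i.
  by rewrite i0 !sqrtr0 sqrtr1 sqrtr1 !mulr0 subrr mulr0; lra.
have i1 : 1 <= i%:R :> R by rewrite ler1n.
move: (Num.sqrt (Num.sqrt i%:R)) aE a0 => a aE a0.
move: (Num.sqrt (Num.sqrt i.*2.+1%:R)) yE y0 => y yE y0.
rewrite -yE -aE; rewrite -yE in jE; rewrite -aE in iE.
have r0 : 0 <= r by lra.
have h1 : r * a ^+ 2 <= y ^+ 2.
  rewrite -(@ler_pXn2r _ 2) ?nnegrE ?sqr_ge0 ?mulr_ge0 ?sqr_ge0//.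
  by rewrite exprMn r2 jE iE; lra.
(* Compared in fourth powers: [15^4 (2i + 1) <= 4 * 14^4 i] follows from [2i + 1 <= 3i]. *)
have h2 : 15 * y <= 14 * (r * a).
  have ra0 : 0 <= r * a by rewrite mulr_ge0.
  rewrite -(@ler_pXn2r _ 4) ?nnegrE ?mulr_ge0//.
  have y4 : y ^+ 4 = 2 * i%:R + 1 by rewrite -jE -exprM.
  have a4 : a ^+ 4 = i%:R by rewrite -iE -exprM.
  have r4 : r ^+ 4 = 4 by rewrite (exprM r 2 2) r2 -natrX.
  by rewrite !exprMn y4 a4 r4; lra.
lra.
Qed.

Section event.
Variables (n m : nat) (x : R) (n_gt0 : (0 < n)%N) (x_ge1 : 1 <= x).
Hypothesis n_le : (n <= 2 ^ m)%N.
Local Notation Q := (iid_law (null_law pi0_01) n).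

Let s := Num.sqrt (20 * x).

Let s_ge0 : 0 <= s. Proof. exact: sqrtr_ge0. Qed.

(** Indexed leftwards from 1, so that [i / 2^l] is the value of [1 - lambda]. *)
Definition dyadic (l i : nat) : R := 1 - i%:R / 2 ^+ l.

(** Open on the left and closed on the right, to be exactly the increment between two tail counts,
    which use a strict inequality. *)
Definition cell (l i : nat) : set T :=
  `]dyadic l i.+1, dyadic l i]%classic.

Lemma measurable_cell l i : measurable (cell l i).
Proof. exact: measurable_itv. Qed.

Definition sparse_cell (l i : nat) : set (n.-tuple T) :=
  [set p | \sum_(j < n) \1_(cell l i) (tnth p j) <=
    n%:R * (pi0 / 2 ^+ l) -
    s * Num.sqrt (Num.sqrt i.+1%:R) * Num.sqrt (n%:R / 2 ^+ l)].

Lemma measurable_sparse_cell l i : measurable (sparse_cell l i).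
Proof.
apply: measurable_le_cst; apply: measurable_count; exact: measurable_cell.
Qed.

Let pow2_gt0 l : 0 < 2 ^+ l :> R. Proof. by rewrite exprn_gt0. Qed.

Let n_gt0' : 0 < n%:R :> R. Proof. by rewrite ltr0n. Qed.

(** Apply the lower tail with [v = 1 / 2^l]. With [k = sqrt (i + 1)] the exponent is [- 5 x k], at
    most [- x - 4 k] since [x] and [k] are at least 1, and [expR (4 k) >= k^4 = (i + 1)^2]. *)
Lemma iid_law_sparse_cell l i : (i < 2 ^ l)%N ->
  (Q (sparse_cell l i) <= (expR (- x) / i.+1%:R ^+ 2)%:E)%E.
Proof.
move=> il; case/andP: (pi0_01) => pi00 pi01.
have Pc : null_law pi0_01 (cell l i) = (pi0 / 2 ^+ l)%:E.
  rewrite null_law_itv.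
  - by rewrite /dyadic -natr1; congr (_%:E); field; rewrite gt_eqF.
  - by rewrite /dyadic subr_ge0 ler_pdivrMr// mul1r -natrX ler_nat.
  - by rewrite /dyadic lerD2l lerN2 ler_wpM2r ?invr_ge0 ?(ltW (pow2_gt0 _))// ler_nat.
  - by rewrite /dyadic gerBl mulr_ge0// invr_ge0 ltW.
have v0 : 0 < n%:R * (2 ^+ l)^-1 :> R by rewrite divr_gt0.
apply: (le_trans (iid_law_lower_tail (measurable_cell l i) Pc _ v0 _)).
- by rewrite ler_piMl// invr_ge0 ltW.
- by rewrite !mulr_ge0 ?sqrtr_ge0.
rewrite lee_fin !exprMn (sqr_sqrtr (ltW v0)).
have -> : s ^+ 2 = 20 * x by rewrite sqr_sqrtr ?mulr_ge0 ?(le_trans ler01 x_ge1).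
rewrite sqr_sqrtr ?sqrtr_ge0//.
set k := Num.sqrt _.
have k1 : 1 <= k by rewrite -sqrtr1 ler_wsqrtr// ler1n.
have -> : 20 * x * k * (n%:R / 2 ^+ l) / (4 * (n%:R / 2 ^+ l)) = 5 * x * k.
  by field; rewrite !gt_eqF.
have -> : i.+1%:R = k ^+ 2 by rewrite sqr_sqrtr.
apply: (@le_trans _ _ (expR (- x - 4 * k))).
  have h1 : x <= x * k by rewrite ler_peMr// (le_trans ler01 x_ge1).
  have h2 : k <= x * k by rewrite ler_peMl// (le_trans ler01 k1).
  by rewrite ler_expR; lra.
rewrite expRD ler_wpM2l ?expR_ge0// expRN lef_pV2 ?posrE ?expR_gt0//; last first.
  by rewrite !exprn_gt0// (lt_le_trans _ k1).
rewrite -exprM (expRM_natl 4 k) ler_pXn2r ?nnegrE ?expR_ge0//.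
  by rewrite (le_trans _ (expR_ge1Dx _))// lerDr.
by rewrite (le_trans ler01 k1).
Qed.

Lemma sum_inv_sqr_le k : \sum_(i < k) (i.+1%:R ^+ 2)^-1 <= 2 :> R.
Proof.
case: k => [|k]; first by rewrite big_ord0.
(* The bound is strengthened by a telescoping term to make the induction go through. *)
suff : \sum_(i < k.+1) (i.+1%:R ^+ 2)^-1 <= 2 - k.+1%:R^-1 :> R.
  by move=> h; apply: (le_trans h); rewrite gerBl.
elim: k => [|k IH]; first by rewrite big_ord1 expr1n invr1; lra.
rewrite big_ord_recr/=; apply: (le_trans (lerD IH (lexx _))).
have k0 : 0 < k.+1%:R :> R by rewrite ltr0n.
rewrite -[k.+2%:R]natr1; move: (k.+1%:R) k0 => y y0.
have y10 : 0 < y + 1 by rewrite addr_gt0.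
rewrite -subr_ge0.
have -> : 2 - (y + 1)^-1 - (2 - y^-1 + ((y + 1) ^+ 2)^-1) =
    (y * (y + 1) ^+ 2)^-1 by field; rewrite !gt_eqF.
by rewrite invr_ge0 mulr_ge0 ?exprn_ge0 ?ltW.
Qed.

Lemma tail_count_cell (p : n.-tuple T) l i :
  tail_count p (dyadic l i.+1) =
  \sum_(j < n) \1_(cell l i) (tnth p j) + tail_count p (dyadic l i).
Proof.
rewrite /tail_count -big_split/=; apply: eq_bigr => j _.
have le : dyadic l i.+1 <= dyadic l i.
  by rewrite /dyadic lerD2l lerN2 ler_wpM2r ?invr_ge0 ?(ltW (pow2_gt0 _))// ler_nat.
have Eoc y : \1_(cell l i) y = ((dyadic l i.+1 < y) && (y <= dyadic l i))%R%:R :> R.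
  rewrite indicE; congr (_%:R); congr nat_of_bool.
  by apply/idP/idP; rewrite inE /cell/= in_itv/=.
rewrite !indic_itvoy Eoc; set y : R := tnth p j.
have [h1|h1] := ltP (dyadic l i) y.
  by rewrite (le_lt_trans le h1) andbF add0r.
by rewrite andbT addr0.
Qed.

(* Passing from level l to l + 1 turns i into 2i or 2i + 1, and in the latter
   case adds one cell. *)
Lemma dyadic_gap_le (p : n.-tuple T) :
  (forall l i, (l <= m)%N -> (i < 2 ^ l)%N -> ~ sparse_cell l i p) ->
  forall l i, (l <= m)%N -> (i <= 2 ^ l)%N ->
    n%:R * (1 - dyadic l i) * pi0 - tail_count p (dyadic l i) <=
    s * Num.sqrt (n%:R / 2 ^+ l) * chain_weight i.
Proof.
move=> good.
have step l i : (l <= m)%N -> (i < 2 ^ l)%N ->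
    n%:R * (1 - dyadic l i.+1) * pi0 - tail_count p (dyadic l i.+1) <=
    n%:R * (1 - dyadic l i) * pi0 - tail_count p (dyadic l i) +
    s * Num.sqrt (n%:R / 2 ^+ l) * Num.sqrt (Num.sqrt i.+1%:R).
  move=> lm il; have /negP := good l i lm il; rewrite -ltNge => h.
  rewrite tail_count_cell.
  have -> : n%:R * (1 - dyadic l i.+1) * pi0 =
      n%:R * (1 - dyadic l i) * pi0 + n%:R * (pi0 / 2 ^+ l).
    by rewrite /dyadic -natr1; ring.
  by lra.
elim=> [|l IH] i lm il.
  rewrite expn0 in il; case: i il => [_|[_|//]].
    rewrite /chain_weight !sqrtr0 !mulr0 subrr mulr0 /dyadic !mul0r subr0 subrr.
    by rewrite mulr0 mul0r sub0r oppr_le0 tail_count_ge0.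
  apply: (le_trans (step 0 0 lm _)) => //.
  rewrite /chain_weight !sqrtr1 /dyadic !mul0r subr0 subrr mulr0 mul0r sub0r.
  have := tail_count_ge0 p 1.
  have : 0 <= s * Num.sqrt (n%:R / 2 ^+ 0) by rewrite mulr_ge0 ?sqrtr_ge0.
  by lra.
have dE k : dyadic l.+1 k.*2 = dyadic l k.
  by rewrite /dyadic -muln2 natrM exprS; congr (1 - _); field; rewrite gt_eqF.
have sE : Num.sqrt (n%:R / 2 ^+ l) = Num.sqrt 2 * Num.sqrt (n%:R / 2 ^+ l.+1) :> R.
  by rewrite -sqrtrM// exprS; congr Num.sqrt; field; rewrite gt_eqF.
have w0 : 0 <= s * Num.sqrt (n%:R / 2 ^+ l.+1) by rewrite mulr_ge0 ?sqrtr_ge0.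
have IH' k : (k <= 2 ^ l)%N ->
    n%:R * (1 - dyadic l k) * pi0 - tail_count p (dyadic l k) <=
    s * Num.sqrt (n%:R / 2 ^+ l.+1) * (Num.sqrt 2 * chain_weight k).
  move=> kl; apply: (le_trans (IH k (ltnW lm) kl)).
  by rewrite sE le_eqVlt; apply/orP; left; apply/eqP; ring.
rewrite -(odd_double_half i); case: (boolP (odd i)) => oi; last first.
  rewrite add0n dE; apply: le_trans (IH' _ _) _.
    by rewrite leq_half_double -mul2n -expnS (leq_trans il).
  by rewrite ler_wpM2l// chain_weight_double.
have hl : (i./2 < 2 ^ l)%N.
  rewrite -(ltn_double) -mul2n -[(2 ^ l).*2]mul2n -expnS mul2n.
  by move: il; rewrite -{1}(odd_double_half i) oi.
rewrite add1n; apply: (le_trans (step _ _ lm _)).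
  by rewrite expnS mul2n ltn_double.
rewrite dE; apply: (le_trans (lerD (IH' _ (ltnW hl)) (lexx _))).
by rewrite -mulrDr ler_wpM2l// chain_weight_doubleS.
Qed.

(** If [n (1 - lambda) <= 1], the trivial bound on the gap gives 1. Otherwise [1 - lambda] is
    rounded down to the grid of depth [m], which costs at most [n / 2^m <= 1] in the numerator,
    hence at most 1 after division by [sqrt w >= 1]. *)
Lemma T_stat_le_of_good (p : n.-tuple T) :
  (forall l i, (l <= m)%N -> (i < 2 ^ l)%N -> ~ sparse_cell l i p) ->
  T_stat pi0 p <= 15 * s + 1.
Proof.
move=> good; case/andP: (pi0_01) => pi00 pi01.
apply: T_stat_le => lam /andP[lam0 lam1].
have u0 : 0 < 1 - lam by rewrite subr_gt0.
set w := n%:R * (1 - lam).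
have w0 : 0 < w by rewrite mulr_gt0.
have [w1|w1] := leP w 1.
  apply: (@le_trans _ _ (Num.sqrt w)).
    by apply: scaled_gap_le; rewrite (ltW pi00).
  apply: (@le_trans _ _ 1); first by rewrite -sqrtr1 ler_wsqrtr.
  by rewrite lerDr mulr_ge0.
have sw1 : 1 <= Num.sqrt w by rewrite -sqrtr1 ler_wsqrtr// ltW.
rewrite scaled_gapE// ler_pdivrMr ?(lt_le_trans _ sw1)// -/w.
set i := Num.trunc (2 ^+ m * (1 - lam)).
have /andP[i1 i2] : i%:R <= 2 ^+ m * (1 - lam) < i.+1%:R.
  by apply: truncn_itv; rewrite mulr_ge0 ?ltW.
have im : (i <= 2 ^ m)%N.
  by rewrite -(ler_nat R) natrX (le_trans i1)// ler_piMr ?(ltW (pow2_gt0 _))// gerBl.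
have := dyadic_gap_le good (leqnn m) im.
have dl : lam <= dyadic m i.
  rewrite /dyadic lerBrDl -lerBrDr ler_pdivrMr//; lra.
have d1 : n%:R * (1 - lam) * pi0 <= n%:R * (1 - dyadic m i) * pi0 + 1.
  have h1 : (1 - lam) <= (1 - dyadic m i) + (2 ^+ m)^-1.
    rewrite /dyadic (_ : 1 - (1 - _) = i%:R / 2 ^+ m); last by ring.
    rewrite -[X in _ <= _ + X]mul1r -mulrDl ler_pdivlMr//.
    by rewrite mulrC natr1 ltW.
  have h2 : n%:R * (2 ^+ m)^-1 <= 1 :> R.
    by rewrite ler_pdivrMr// mul1r -natrX ler_nat.
  have h3 : n%:R * (1 - lam) * pi0 <=
      n%:R * (1 - dyadic m i + (2 ^+ m)^-1) * pi0.
    by rewrite ler_wpM2r ?(ltW pi00)// ler_wpM2l.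
  have h4 : 0 <= n%:R * (2 ^+ m)^-1 :> R by rewrite divr_ge0// ltW.
  apply: (le_trans h3); rewrite mulrDr mulrDl lerD2l.
  by rewrite mulr_ile1// ltW.
have tl := tail_count_le p dl.
have cw : s * Num.sqrt (n%:R / 2 ^+ m) * chain_weight i <= 15 * s * Num.sqrt w.
  apply: (@le_trans _ _ (s * Num.sqrt (n%:R / 2 ^+ m) * (15 * Num.sqrt i%:R))).
    rewrite ler_wpM2l ?mulr_ge0 ?sqrtr_ge0// /chain_weight gerBl.
    by rewrite mulr_ge0 ?sqrtr_ge0.
  rewrite (_ : _ * _ = 15 * s * (Num.sqrt (n%:R / 2 ^+ m) * Num.sqrt i%:R)); last by ring.
  rewrite ler_wpM2l ?mulr_ge0// -sqrtrM ?divr_ge0 ?(ltW (pow2_gt0 _))// ler_wsqrtr//.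
  by rewrite /w -mulrA ler_wpM2l// mulrC ler_pdivrMr// mulrC.
rewrite /w in d1 *; lra.
Qed.

(** Union bound: the failures within one level sum to at most [2 * expR (- x)], and there are
    [m + 1] levels. *)
Lemma null_T_stat_gt :
  (Q [set p | (15 * s + 1 < T_stat pi0 p)%R] <=
   ((m.+1)%:R * (2 * expR (- x)))%:E)%E.
Proof.
pose B l := \big[setU/set0]_(i < 2 ^ l) sparse_cell l i.
have mB l : measurable (B l).
  by apply: bigsetU_measurable => i _; exact: measurable_sparse_cell.
apply: (@le_trans _ _ (Q (\big[setU/set0]_(l < m.+1) B l))).
  apply: le_measure; rewrite ?inE.
  - exact: measurable_T_stat_gt.
  - by apply: bigsetU_measurable => l _.
  move=> p /= pT; apply: contrapT => np; move: pT; apply/negP; rewrite -leNgt.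
  apply: T_stat_le_of_good => l i lm il pli; apply: np.
  rewrite -(bigcup_mkord m.+1 B); exists l => //=.
  by rewrite /B -(bigcup_mkord (2 ^ l) (sparse_cell l)); exists i.
apply: (le_trans (Boole_inequality _ _)) => //.
have -> : ((m.+1%:R * (2 * expR (- x)))%:E =
    \sum_(l < m.+1) (2 * expR (- x))%:E)%E.
  by rewrite sumEFin sumr_const card_ord mulr_natl.
apply: lee_sum => l _.
apply: (le_trans (Boole_inequality _ _)).
  by move=> i _; exact: measurable_sparse_cell.
apply: (@le_trans _ _ (\sum_(i < 2 ^ l) (expR (- x) / i.+1%:R ^+ 2)%:E)%E).
  by apply: lee_sum => i _; exact: iid_law_sparse_cell.
rewrite sumEFin lee_fin -mulr_sumr mulrC ler_wpM2r ?expR_ge0//.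
exact: sum_inv_sqr_le.
Qed.

End event.

End null_tail.

(** * Growth of the critical value and power under the alternative *)

Section asymptotics.
Context (R : realType).
Local Notation lnln n := (ln (ln n%:R) : R).

(** Collects what is needed of large [n]; the threshold is [expR (expR M)]. *)
Lemma lnln_ge (M : R) : \forall n \near \oo,
  [/\ (0 < n)%N, M <= lnln n, ln n%:R = expR (lnln n) :> R &
      lnln n <= n%:R].
Proof.
have := nbhs_infty_ger (expR (expR M)); apply: filterS => n hn.
have n0 : 0 < n%:R :> R := lt_le_trans (expR_gt0 _) hn.
have hln : expR M <= ln n%:R by rewrite -(expRK (expR M)) ler_ln ?posrE ?expR_gt0.
have ln0 : 0 < ln n%:R :> R := lt_le_trans (expR_gt0 _) hln.
have le_expR (y : R) : y <= expR y.
  by rewrite (le_trans _ (expR_ge1Dx _))// lerDr.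
split; first by rewrite ltr0n in n0.
- by rewrite -(expRK M) ler_ln ?posrE ?expR_gt0.
- by rewrite lnK.
- apply: (le_trans (le_expR _)); rewrite lnK// (le_trans (le_expR _))//.
  by rewrite lnK.
Qed.

Lemma exists_dyadic_depth n : (0 < n)%N -> 1 <= ln n%:R :> R ->
  exists2 m, (n <= 2 ^ m)%N & m.+1%:R <= 4 * ln n%:R :> R.
Proof.
move=> n0 ln1; have /andP[k1 k2] := trunc_log_bounds (ltnSn 1) n0.
(* From [expR (1/2) <= 2] one gets [k <= 2 ln n], so [m + 1 = k + 2 <= 4 ln n] once [ln n >= 1]. *)
set k := trunc_log 2 n in k1 k2; exists k.+1; first exact: ltnW.
have e2 : expR 2^-1 <= 2 :> R.
  by apply: (le_trans (expR_le_quadratic _)); [rewrite invr_ge0 lexx andbT|lra].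
have : k%:R / 2 <= ln n%:R :> R.
  rewrite -ler_expR lnK ?posrE ?ltr0n// expRM_natl.
  apply: (@le_trans _ _ (2 ^+ k)); last by rewrite -natrX ler_nat.
  by rewrite lerXn2r ?nnegrE ?expR_ge0.
by rewrite -[k.+2%:R]natr1 -[k.+1%:R]natr1; lra.
Qed.

Lemma crit_value_lnln_le (pi0 alpha : R) (pi0_01 : 0 < pi0 <= 1)
    (alpha_01 : 0 < alpha < 1) :
  \forall n \near \oo,
    crit_value pi0_01 alpha n <= 106 * Num.sqrt (lnln n).
Proof.
case/andP: (alpha_01) => al0 al1.
have := lnln_ge (Num.max 1 (ln (8 / alpha))).
apply: filterS => n [n0 + lnE _]; rewrite ge_max => /andP[k1 kal].
move: (lnln n) k1 kal lnE => k k1 kal lnE.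
have ln1 : 1 <= ln n%:R :> R.
  by rewrite lnE (le_trans _ (expR_ge1Dx _))// lerDl; lra.
have [m nm mln] := exists_dyadic_depth n0 ln1.
have al8 : 0 < 8 / alpha by rewrite divr_gt0.
have lal0 : 0 <= ln (8 / alpha).
  by apply: ln_ge0; rewrite ler_pdivlMr//; lra.
(* With at most [4 ln n] levels the failure bound is [4 ln n * 2 * expR (- x)], and this [x] makes
   it exactly [alpha]. *)
set x := ln (8 / alpha) + k.
have x1 : 1 <= x by rewrite /x; lra.
have le_alpha : m.+1%:R * (2 * expR (- x)) <= alpha.
  have -> : expR (- x) = alpha / (8 * ln n%:R).
    rewrite expRN /x expRD lnK ?posrE// -lnE; field.
    by rewrite !gt_eqF//; lra.
  apply: (@le_trans _ _ (4 * ln n%:R * (2 * (alpha / (8 * ln n%:R))))).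
    by rewrite ler_wpM2r// mulr_ge0// divr_ge0//; lra.
  rewrite le_eqVlt; apply/orP; left; apply/eqP; field.
  by rewrite gt_eqF//; lra.
have sk1 : 1 <= Num.sqrt k by rewrite -sqrtr1 ler_wsqrtr.
(* For large [n], [x <= 2 k], so [20 x <= 49 k]; the constant is 106 = 15 * 7 + 1. *)
apply: (@le_trans _ _ (15 * Num.sqrt (20 * x) + 1)); last first.
  have : Num.sqrt (20 * x) <= 7 * Num.sqrt k; last by lra.
  rewrite (_ : 7 = Num.sqrt (7 ^+ 2)); last by rewrite sqrtr_sqr ger0_norm.
  by rewrite -sqrtrM ?sqr_ge0// ler_wsqrtr// /x; lra.
apply: crit_value_le => //.
set E := [set p | _].
have mE : measurable (~` E).
  by apply: measurableC; exact: measurable_T_stat_le.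
have CE : ~` E = [set p | 15 * Num.sqrt (20 * x) + 1 < T_stat pi0 p].
  by apply/seteqP; split => p /=; rewrite /E/= ltNge => /negP.
rewrite -(setCK E) probability_setC// EFinB leeB// CE.
by apply: (le_trans (null_T_stat_gt pi0_01 n0 x1 nm)); rewrite lee_fin.
Qed.

(** * The choice of [u = 1 - lambda] that balances signal and noise *)

Section bandwidth.
Variables (n : nat) (beta : R) (n_gt0 : (0 < n)%N) (beta_ge0 : 0 <= beta).
Hypothesis lnln_ge1 : 1 <= lnln n.
Hypothesis lnln_le : lnln n <= n%:R.

Definition bandwidth : R := (n%:R / lnln n) `^ (- (2 * beta + 1)^-1).

Let n_gt0' : 0 < n%:R :> R. Proof. by rewrite ltr0n. Qed.

Let lnln_gt0 : 0 < lnln n. Proof. exact: lt_le_trans lnln_ge1. Qed.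

Let ratio_gt0 : 0 < n%:R / lnln n. Proof. exact: divr_gt0. Qed.

Lemma bandwidth_gt0 : 0 < bandwidth.
Proof. exact: powR_gt0. Qed.

Lemma bandwidth_le1 : bandwidth <= 1.
Proof.
have r1 : 1 <= n%:R / lnln n by rewrite ler_pdivlMr// mul1r.
have e0 : - (2 * beta + 1)^-1 <= 0.
  by rewrite oppr_le0 invr_ge0 addr_ge0// mulr_ge0.
by have := ler_powR r1 e0; rewrite powRr0.
Qed.

Lemma rate_bandwidth : rate n beta = bandwidth `^ beta.
Proof. by rewrite /rate /bandwidth -powRrM; congr (_ `^ _); rewrite mulNr mulrC. Qed.

Lemma bandwidth_balance :
  n%:R * bandwidth * (bandwidth `^ beta) ^+ 2 = lnln n.
Proof.
rewrite -mulrA -powR_mulrn ?powR_ge0// -powRrM.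
rewrite -{1}(powRr1 (ltW bandwidth_gt0)) -powRD; last first.
  by rewrite (gt_eqF bandwidth_gt0) implybT.
rewrite /bandwidth -powRrM (_ : - _ * _ = -1); last first.
  by field; rewrite gt_eqF// ltr_wpDl// mulr_ge0.
by rewrite powR_inv1 ?ltW// invf_div; field; rewrite gt_eqF.
Qed.

Lemma lnln_le_bandwidth : lnln n <= n%:R * bandwidth.
Proof.
rewrite -bandwidth_balance ler_piMr//.
  by rewrite mulr_ge0// ltW// bandwidth_gt0.
rewrite exprn_ile1 ?powR_ge0//.
have u01 : 0 < bandwidth <= 1 by rewrite bandwidth_gt0 bandwidth_le1.
by have := ger_powR u01 beta_ge0; rewrite powRr0.
Qed.

Lemma sqrt_bandwidth :
  Num.sqrt (n%:R * bandwidth) * bandwidth `^ beta = Num.sqrt (lnln n).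
Proof.
rewrite -bandwidth_balance [in RHS]sqrtrM; last first.
  by rewrite mulr_ge0// ltW// bandwidth_gt0.
by rewrite sqrtr_sqr ger0_norm// powR_ge0.
Qed.

End bandwidth.

Lemma density_law_right_tail_le (f : density01 R) (u M : R) :
  0 < u <= 1 -> (forall x, 1 - u < x <= 1 -> f x <= M) ->
  (density_law f (`](1 - u)%R, +oo[%classic : set (measurableTypeR R)) <=
   (u * M)%:E)%E.
Proof.
move=> /andP[u0 u1] fM; rewrite density_lawE.
have AE : `]1 - u, +oo[%classic `&` `[0, 1]%classic = `]1 - u, 1]%classic :> set R.
  apply/seteqP; split => [x /=|x /=]; rewrite !in_itv/= ?andbT.
    by move=> [-> /andP[_ ->]].
  by move=> /andP[h1 h2]; rewrite h1 h2 andbT; split => //; lra.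
have mA := @density_measurable R f _ (measurable_itv `]1 - u, +oo[).
rewrite AE in mA *.
apply: (@le_trans _ _ (\int[lebesgue_measure]_(x in `](1 - u)%R, 1%R]) M%:E)%E).
  apply: ge0_le_integral => //.
  move=> x /=; rewrite in_itv/= => /andP[h1 h2]; rewrite lee_fin.
  by apply: density_ge0; rewrite in_itv/= h2 andbT; lra.
rewrite integral_cst; last exact: measurable_itv.
have mE : lebesgue_measure (`]1 - u, 1]%classic : set R) = u%:E.
  by rewrite lebesgue_measure_itv/= lte_fin ltrBlDr ltrDl u0 -EFinB subKr.
by rewrite [X in (_ * X)%E]mE -EFinM lee_fin mulrC.
Qed.

(** In the constant [L + 107], the part [L] absorbs the variation of [f] on [[1 - u, 1]], which
    leaves a density at most [pi0 - 107 u^beta] there. Of the remaining 107 units, 106 cover the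
    critical value and 1 is the deviation fed to the upper tail bound. *)
Lemma rejection_prob_ge (pi0 alpha L beta : R) (pi0_01 : 0 < pi0 <= 1)
    (n : nat) (f : density01 R) :
  (0 < n)%N -> 0 < L -> 0 <= beta -> 1 <= lnln n -> lnln n <= n%:R ->
  crit_value pi0_01 alpha n <= 106 * Num.sqrt (lnln n) ->
  alt_class pi0 ((L + 107) * rate n beta) L beta f ->
  ((1 - expR ((1 - Num.sqrt (lnln n)) / 2))%:E <=
    rejection_prob f (phi pi0_01 alpha (n := n)))%E.
Proof.
move=> n0 L0 b0 k1 kn cle [_ f1 fS]; case/andP: (pi0_01) => pi00 pi01.
set u := bandwidth n beta.
have u0 : 0 < u := bandwidth_gt0 beta n0 k1.
have u1 : u <= 1 := bandwidth_le1 b0 k1 kn.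
have nuk : lnln n <= n%:R * u := lnln_le_bandwidth n0 b0 k1 kn.
have uk : Num.sqrt (n%:R * u) * u `^ beta = Num.sqrt (lnln n) :=
  sqrt_bandwidth n0 b0 k1.
have ub0 : 0 <= u `^ beta := powR_ge0 _ _.
rewrite rate_bandwidth// -/u in f1.
set A := `]1 - u, +oo[%classic : set (measurableTypeR R).
have mA : measurable A by exact: measurable_itv.
set q := fine (density_law f A).
have PA : density_law f A = q%:E by rewrite fineK// fin_num_measure.
have qle : q <= u * (pi0 - 107 * u `^ beta).
  rewrite -lee_fin -PA; apply: density_law_right_tail_le; first by rewrite u0.
  move=> x /andP[x1 x2].
  have := fS x 1; rewrite !in_itv/= lexx ler01 x2 andbT => /(_ _ isT).
  have -> : 0 <= x by lra.
  move=> /(_ isT) h; have {}h := le_trans (ler_norm _) h.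
  have : L * `|x - 1| `^ beta <= L * u `^ beta.
    rewrite ler_wpM2l ?(ltW L0)// ge0_ler_powR ?nnegrE// ?(ltW u0)//.
    by rewrite ler_norml; apply/andP; split; lra.
  by lra.
have qu : q <= u.
  apply: (le_trans qle); rewrite ler_piMr ?(ltW u0)//; lra.
have nu1 : 1 <= n%:R * u := le_trans k1 nuk.
set w := Num.sqrt (n%:R * u) in uk.
have w1 : 1 <= w by rewrite -sqrtr1 ler_wsqrtr.
have w0 : 0 < w by rewrite (lt_le_trans _ w1).
rewrite rejection_probE.
set E := [set p | _].
have mE : measurable E by exact: measurable_T_stat_gt.
rewrite -(setCK E) probability_setC; last exact: measurableC.
rewrite EFinB leeB//.
(* Acceptance forces the gap at [1 - u] below the critical value, so the count above [1 - u] exceeds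
   its mean by at least [w * sqrt (lnln n)]. *)
apply: le_trans (iid_law_upper_tail mA PA (n := n) (Num.sqrt (lnln n)) qu nu1).
rewrite -/w; apply: le_measure; rewrite ?inE.
- exact: measurableC.
- by apply: measurable_ge_cst; exact: measurable_count.
move=> p /= /negP; rewrite -leNgt => Tc.
have lam01 : 0 <= 1 - u < 1 by lra.
have := le_trans (T_stat_ge pi0_01 p lam01) (le_trans Tc cle).
rewrite scaled_gapE; last by lra.
rewrite subKr -/w ler_pdivrMr// /tail_count -/A.
have nq : n%:R * q <= n%:R * u * pi0 - 107 * (w * Num.sqrt (lnln n)).
  apply: (@le_trans _ _ (n%:R * (u * (pi0 - 107 * u `^ beta)))).
    by rewrite ler_wpM2l.
  have nuE : n%:R * u = w * w by rewrite -expr2 sqr_sqrtr// (le_trans ler01).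
  by rewrite mulrA nuE -uk; lra.
by set N := \sum_(i < n) _; lra.
Qed.

Lemma lower_bound_cvg :
  (fun n : nat => (1 - expR ((1 - Num.sqrt (lnln n)) / 2))%:E) @ \oo -->
  (1%E : \bar R).
Proof.
apply: cvg_EFin; first exact: nearW.
rewrite /comp/= -[X in _ --> X](subr0 1).
apply: cvgB; first exact: cvg_cst.
have H : (fun n : nat => (Num.sqrt (lnln n) - 1) / 2) @ \oo --> +oo.
  apply/cvgryPge => M.
  have := lnln_ge ((2 * M + 1) ^+ 2); apply: filterS => n [_ h _ _].
  have := ler_wsqrtr h; rewrite sqrtr_sqr => h'.
  by have := le_trans (ler_norm _) h'; lra.
have := cvg_comp _ _ H (@cvgr_expR R).
by apply: cvg_trans; apply: near_eq_cvg; near=> n => /=; congr expR; lra.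
Unshelve. all: by end_near. Qed.

End asymptotics.

Theorem theorem3p1 (R : realType) (pi0 alpha L : R)
    (pi0_01 : 0 < pi0 <= 1) (alpha_01 : 0 < alpha < 1) (L_gt0 : 0 < L) :
  (forall n : nat, (0 < n)%N ->
     has_level alpha (phi pi0_01 alpha (n := n)) (null_hypothesis pi0)) /\
  (exists2 Cstar : R, 0 < Cstar &
     forall eps : R, 0 < eps <= 1 ->
       (fun n : nat => ereal_inf
          [set min_power (phi pi0_01 alpha (n := n))
                 (alt_class pi0 (Cstar * rate n beta) L beta)
          | beta in `[eps, 1]]) @ \oo --> (1%E : \bar R)).
Proof.
split; first by move=> n _; exact: phi_has_level.
exists (L + 107); first by lra.
move=> eps /andP[eps0 eps1].
(* The lower bound on the power depends on neither [beta] nor [f], so it bounds both infima at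
   once. *)
apply: (squeeze_cvge _ (@lower_bound_cvg R) (cvg_cst 1%E)).
have := lnln_ge (1 : R).
have := crit_value_lnln_le pi0_01 alpha_01; apply: filterS2 => n cle [n0 k1 _ kn].
have rej_le1 f : (rejection_prob f (phi pi0_01 alpha (n := n)) <= 1)%E.
  by rewrite rejection_probE; apply: probability_le1; exact: measurable_T_stat_gt.
apply/andP; split.
  apply: le_ereal_inf_tmp => _ [beta /= + <-]; rewrite in_itv/= => /andP[be b1].
  rewrite /min_power; case: asboolP => [_|_].
    by rewrite lee_fin gerBl expR_ge0.
  apply: le_ereal_inf_tmp => _ [f fG <-].
  by apply: (rejection_prob_ge (L := L) (beta := beta)) => //; lra.
(* The infimum is at most 1 because its value at [beta = 1] is, whether that class is empty or
   not. *)
apply: (@le_trans _ _ (min_power (phi pi0_01 alpha (n := n))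
    (alt_class pi0 ((L + 107) * rate n 1) L 1))).
  by apply: ereal_inf_lbound; exists 1 => //=; rewrite in_itv/= eps1 lexx.
rewrite /min_power; case: asboolP => // /eqP/set0P[f fG].
by apply: (le_trans _ (rej_le1 f)); apply: ereal_inf_lbound; exists f.
Qed.
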